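(* Let $(G,\mathcal{U},\varphi)$ be a self-similar ultragraph. Then the map $\pi:\mathcal{S}_{G,\mathcal{U}}\to\mathcal{O}_{G,\mathcal{U}}$ defined by $\pi(0)=0$ and $$\pi(\alpha,A,g,\beta)=s_\alpha u_{A,g}s_\beta^*\qquad((\alpha,A,g,\beta)\in\mathcal{S}_{G,\mathcal{U}}),$$ where $s_\omega$ denotes the identity of the multiplier algebra $\mathcal{M}(\mathcal{O}_{G,\mathcal{U}})$, is a tight representation.
   Context: **Ultragraphs.** An ultragraph $\mathcal{U}=(U^0,\mathcal{U}^1,r,s)$ consists of a set $U^0$ of vertices, a set $\mathcal{U}^1$ of edges and maps $r,s:\mathcal{U}^1\to P(U^0)\setminus\{\emptyset\}$ ($P$ = power set) such that $r(e)$ is a singleton for every $e$. Standing assumption: $\mathcal{U}$ is row-finite without sources, i.e. $\{e\in\mathcal{U}^1: r(e)=\{v\}\}$ is nonempty and finite for all $v\in U^0$. $\mathcal{U}^0$ denotes the smallest subset of $P(U^0)$ containing $\emptyset$, all $\{v\}$ ($v\in U^0$), all $s(e)$ ($e\in\mathcal{U}^1$), and closed under finite $\cap,\cup,\setminus$. A path of length $n\ge1$ is a sequence $\alpha=e_1\cdots e_n$ of edges with $r(e_{i+1})\subseteq s(e_i)$; $r(\alpha)=r(e_1)$, $s(\alpha)=s(e_n)$, $|\alpha|=n$; $\mathcal{U}^{\ge1}$ is the set of all such paths. Concatenation $\alpha\beta$ is defined when $r(\beta)\subseteq s(\alpha)$. **Self-similar ultragraph.** A triple $(G,\mathcal{U},\varphi)$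 where $\mathcal{U}=(U^0,\mathcal{U}^1,r,s)$ is a row-finite ultragraph without sources, $G$ is a countable discrete group with identity $1_G$ acting on $U^0\sqcup\mathcal{U}^1$ by ultragraph automorphisms (bijections preserving $U^0$ and $\mathcal{U}^1$ with $r(g\cdot e)=g\cdot r(e)$, $s(g\cdot e)=g\cdot s(e)$, where $g\cdot A=\{g\cdot v:v\in A\}$), and $\varphi:G\times\mathcal{U}^1\to G$ satisfies $\varphi(gh,e)=\varphi(g,h\cdot e)\varphi(h,e)$ and $\varphi(g,e)\cdot s(e)\subseteq g\cdot s(e)$. Extend to paths inductively by $g\cdot(\alpha_1\alpha_2)=(g\cdot\alpha_1)(\varphi(g,\alpha_1)\cdot\alpha_2)$, $\varphi(g,\alpha_1\alpha_2)=\varphi(\varphi(g,\alpha_1),\alpha_2)$. **The inverse semigroup $\mathcal{S}_{G,\mathcal{U}}$.** Add a universal path $\omega$ of length zero with $\omega\omega=\omega$, $\omega\alpha=\alpha\omega=\alpha$, $s(\omega)=r(\omega)=U^0$, $g\cdot\omega=\omega$, $\varphi(g,\omega)=g$; put $\mathcal{U}^\sharp=\{\omega\}\cup\mathcal{U}^{\ge1}$. Let $\mathcal{S}_{G,\mathcal{U}}=\{(\alpha,A,g,\beta):\alpha,\beta\in\mathcal{U}^\sharp, A\in\mathcal{U}^0, g\in G, \emptyset\ne A\subseteq s(\alpha)\cap g\cdot s(\beta)\}\cup\{0\}$, where $0$ is a zero element, with inverse $(\alpha,A,g,\beta)^*=(\beta,g^{-1}\cdot A,g^{-1},\alpha)$,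 $0^*=0$, and product $(\alpha,A,g,\beta)(\gamma,B,h,\delta)$ equal to - $(\alpha(g\cdot\varepsilon),\ (g\cdot s(\varepsilon))\cap(\varphi(g,\varepsilon)\cdot B),\ \varphi(g,\varepsilon)h,\ \delta)$ if $\gamma=\beta\varepsilon$, $\varepsilon\in\mathcal{U}^{\ge1}$, $g\cdot r(\varepsilon)\subseteq A$; - $(\alpha,\ A\cap(g\varphi(h^{-1},\varepsilon)^{-1}h^{-1}\cdot s(\beta)),\ g\varphi(h^{-1},\varepsilon)^{-1},\ \delta(h^{-1}\cdot\varepsilon))$ if $\beta=\gamma\varepsilon$, $\varepsilon\in\mathcal{U}^{\ge1}$, $r(\varepsilon)\subseteq B$; - $(\alpha,A\cap(g\cdot B),gh,\delta)$ if $\gamma=\beta$ and $A\cap(g\cdot B)\neq\emptyset$; - $0$ otherwise. With these operations $\mathcal{S}_{G,\mathcal{U}}$ is taken to be an inverse semigroup with zero. **The $C^*$-algebra $\mathcal{O}_{G,\mathcal{U}}$.** A Cuntz–Krieger $\mathcal{U}$-family consists of partial isometries $\{s_e:e\in\mathcal{U}^1\}$ with mutually orthogonal ranges and projections $\{p_A:A\in\mathcal{U}^0\}$ with (CK1) $p_\emptyset=0$, $p_Ap_B=p_{A\cap B}$, $p_{A\cup B}=p_A+p_B-p_{A\cap B}$; (CK2) $s_e^*s_e=p_{s(e)}$; (CK3) $s_es_e^*\le p_{r(e)}$; (CK4) $p_{\{v\}}=\sum_{r(e)=\{v\}}s_es_e^*$ for $v\in U^0$. A $(G,\mathcal{U})$-family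 is a collection $\{p_A,s_e\}\cup\{u_{A,g}:A\in\mathcal{U}^0,g\in G\}$ in a $C^*$-algebra such that (1) $\{p_A,s_e\}$ is a Cuntz–Krieger $\mathcal{U}$-family; (2) $u_{A,1_G}=p_A$; (3) $u_{A,g}^*=u_{g^{-1}\cdot A,g^{-1}}$; (4) $u_{A,g}u_{B,h}=u_{A\cap(g\cdot B),gh}$; (5) $u_{A,g}s_e=s_{g\cdot e}u_{g\cdot s(e),\varphi(g,e)}$ if $g\cdot r(e)\subseteq A$, and $u_{A,g}s_e=0$ otherwise. $\mathcal{O}_{G,\mathcal{U}}$ is the universal $C^*$-algebra generated by a $(G,\mathcal{U})$-family $\{p_A,s_e,u_{A,g}\}$. For $\alpha=e_1\cdots e_n\in\mathcal{U}^{\ge1}$, $s_\alpha=s_{e_1}\cdots s_{e_n}$. **Tight representations.** For an inverse semigroup $\mathcal{S}$ with zero and idempotent semilattice $\mathcal{E}(\mathcal{S})$ (ordered by $e\le f\iff ef=e$), a representation in a $C^*$-algebra $\mathcal{A}$ is a map $\psi:\mathcal{S}\to\mathcal{A}$ with $\psi(0)=0$, $\psi(st)=\psi(s)\psi(t)$, $\psi(s^* )=\psi(s)^*$. For finite $X,Y\subseteq\mathcal{E}(\mathcal{S})$ let $\mathcal{E}(\mathcal{S})^{X,Y}=\{e\in\mathcal{E}(\mathcal{S}): e\le f\ \forall f\in X,\ ef'=0\ \forall f'\in Y\}$; a cover of it is a subset $Z\subseteq\mathcal{E}(\mathcal{S})^{X,Y}$ such that every nonzero $e\in\mathcal{E}(\mathcal{S})^{X,Y}$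 satisfies $ez\ne0$ for some $z\in Z$. $\psi$ is tight if for all finite $X,Y$ and every finite cover $Z$ of $\mathcal{E}(\mathcal{S})^{X,Y}$, $\bigvee_{e\in Z}\psi(e)=\bigwedge_{f\in X}\psi(f)\wedge\bigwedge_{f'\in Y}(1-\psi(f'))$ (lattice operations of commuting projections, $1$ the unit of the multiplier algebra of $\mathcal{A}$, empty meets equal $1$, empty joins equal $0$). *)

(* Defs.v *)
From HB Require Import structures.
From Stdlib Require List.
From mathcomp Require Import all_boot all_order all_algebra.
From mathcomp Require Import all_classical all_reals all_analysis.
From mathcomp Require Import complex.

Set Implicit Arguments.
Unset Strict Implicit.
Unset Printing Implicit Defensive.

Import Order.TTheory GRing.Theory Num.Theory.
Import numFieldNormedType.Exports.

Local Open Scope classical_set_scope.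
Local Open Scope ring_scope.

(** * C*-algebras, not assumed to be unital *)

HB.mixin Record isCStarAlgebra (R : realType) A
    of CompleteNormedModule R[i] A := {
  cmul : A -> A -> A;
  cstar : A -> A;
  cmulA : forall x y z, cmul x (cmul y z) = cmul (cmul x y) z;
  cmulDl : forall x y z, cmul (x + y) z = cmul x z + cmul y z;
  cmulDr : forall x y z, cmul x (y + z) = cmul x y + cmul x z;
  cmulZl : forall (k : R[i]) x y, cmul (k *: x) y = k *: cmul x y;
  cmulZr : forall (k : R[i]) x y, cmul x (k *: y) = k *: cmul x y;
  cstarK : forall x, cstar (cstar x) = x;
  cstarD : forall x y, cstar (x + y) = cstar x + cstar y;
  cstarZ : forall (k : R[i]) x, cstar (k *: x) = (k^*)%R *: cstar x;
  cstarM : forall x y, cstar (cmul x y) = cmul (cstar y) (cstar x);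
  cnormM : forall x y, `|cmul x y| <= `|x| * `|y|;
  cnormC : forall x, `|cmul (cstar x) x| = `|x| ^+ 2
}.

#[short(type="cstarAlgType")]
HB.structure Definition CStarAlgebra (R : realType) :=
  {A of isCStarAlgebra R A & CompleteNormedModule R[i] A}.

Declare Scope cstar_scope.
Delimit Scope cstar_scope with cstar.
Notation "x ** y" := (cmul x y) (at level 40, left associativity) : cstar_scope.
Notation "x ^#" := (cstar x) (at level 2, format "x ^#") : cstar_scope.
Local Open Scope cstar_scope.

Definition star_hom (R : realType) (A B : cstarAlgType R) (h : A -> B) : Prop :=
  [/\ forall x y, h (x + y) = h x + h y,
      forall (k : R[i]) x, h (k *: x) = k *: h x,
      forall x y, h (x ** y) = h x ** h y &
      forall x, h x^# = (h x)^#].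

Definition closed_star_subalg (R : realType) (A : cstarAlgType R) (D : set A)
    : Prop :=
  [/\ closed D, D 0, forall x y, D x -> D y -> D (x + y),
      forall (k : R[i]) x, D x -> D (k *: x) &
      (forall x y, D x -> D y -> D (x ** y)) /\ (forall x, D x -> D x^#)].

Definition is_proj (R : realType) (A : cstarAlgType R) (p : A) : Prop :=
  p ** p = p /\ p^# = p.

Definition is_partial_isometry (R : realType) (A : cstarAlgType R) (s : A)
    : Prop := s ** s^# ** s = s.

(* The order of projections. *)
Definition proj_le (R : realType) (A : cstarAlgType R) (p q : A) : Prop :=
  p ** q = p.

(** * The multiplier algebra

   M(A) is realised as the *-algebra of double centralisers (L, R) of A, where
   m = (L, R) acts by m a = L a and a m = R a.  Linearity and boundedness of L
   and R follow from the identity a (L b) = (R a) b. *)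

Record multiplier (R : realType) (A : cstarAlgType R) := Multiplier {
  lmult : A -> A;
  rmult : A -> A;
  multP : forall a b, a ** lmult b = rmult a ** b }.

Section Multipliers.
Variables (R : realType) (A : cstarAlgType R).
Implicit Types (m n : multiplier A).

Fact cmul0l (a : A) : 0 ** a = 0.
Proof. by have := cmulZl (0 : R[i]) (0 : A) a; rewrite !scale0r. Qed.

Fact cmul0r (a : A) : a ** 0 = 0.
Proof. by have := cmulZr (0 : R[i]) a (0 : A); rewrite !scale0r. Qed.

Fact m0P (a b : A) : a ** 0 = 0 ** b.
Proof. by rewrite cmul0l cmul0r. Qed.

Definition m0 : multiplier A := @Multiplier R A (fun=> 0) (fun=> 0) m0P.

Definition m1 : multiplier A := @Multiplier R A id id (fun _ _ => erefl).

Fact maddP m n (a b : A) :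
  a ** (lmult m b + lmult n b) = (rmult m a + rmult n a) ** b.
Proof. by rewrite cmulDr cmulDl !multP. Qed.

Definition madd m n : multiplier A := Multiplier (maddP m n).

Fact moppP m (a b : A) : a ** (- lmult m b) = (- rmult m a) ** b.
Proof. by rewrite -[- lmult m b]scaleN1r -[- rmult m a]scaleN1r cmulZl cmulZr multP. Qed.

Definition mopp m : multiplier A := Multiplier (moppP m).

Fact mmulP m n (a b : A) :
  a ** lmult m (lmult n b) = rmult n (rmult m a) ** b.
Proof. by rewrite !multP. Qed.

Definition mmul m n : multiplier A := Multiplier (mmulP m n).

Fact mstarP m (a b : A) : a ** (rmult m b^#)^# = (lmult m a^#)^# ** b.
Proof.
by rewrite -[a in LHS]cstarK -cstarM -multP cstarM cstarK.
Qed.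

Definition mstar m : multiplier A := Multiplier (mstarP m).

Definition minj (a : A) : multiplier A :=
  @Multiplier R A (fun b => a ** b) (fun b => b ** a)
    (fun b c => cmulA b a c).

(* Lattice operations of commuting projections. *)
Definition mmeet m n := mmul m n.
Definition mjoin m n := madd (madd m n) (mopp (mmul m n)).
Definition mcompl m := madd m1 (mopp m).

End Multipliers.

Arguments m0 {R A}.
Arguments m1 {R A}.

(** * Inverse semigroups with zero and tight representations

   The underlying set is a subset [sg_dom] of an ambient type; the values of
   the operations outside it are irrelevant. *)

Record invsg_data (T : Type) := InvSgData {
  sg_dom : set T;
  sg_mul : T -> T -> T;
  sg_inv : T -> T;
  sg_zero : T }.

Section InverseSemigroups.
Variables (T : Type) (S : invsg_data T).

Definition is_inverse_semigroup0 : Prop :=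
  let D := sg_dom S in let mul := sg_mul S in
  let inv := sg_inv S in let z := sg_zero S in
  [/\ [/\ D z, forall s t, D s -> D t -> D (mul s t) &
          forall s, D s -> D (inv s)],
      forall s t u, D s -> D t -> D u -> mul s (mul t u) = mul (mul s t) u,
      forall s, D s -> mul z s = z /\ mul s z = z,
      forall s, D s -> mul (mul s (inv s)) s = s /\
                       mul (mul (inv s) s) (inv s) = inv s &
      forall s t, D s -> D t -> mul (mul s t) s = s -> mul (mul t s) t = t ->
        t = inv s].

Definition idempotents : set T :=
  [set e | sg_dom S e /\ sg_mul S e e = e].

Definition sg_le (e f : T) : Prop := sg_mul S e f = e.

(* Finite subsets are given by lists enumerating them. *)
Definition list_sub (X : seq T) (D : set T) : Prop :=
  forall e, List.In e X -> D e.

Definition idem_between (X Y : seq T) : set T :=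
  [set e | [/\ idempotents e, forall f, List.In f X -> sg_le e f &
               forall f, List.In f Y -> sg_mul S e f = sg_zero S]].

Definition finite_cover (Z : seq T) (F : set T) : Prop :=
  list_sub Z F /\
  forall e, F e -> e <> sg_zero S ->
    exists2 z, List.In z Z & sg_mul S e z <> sg_zero S.

Variables (R : realType) (A : cstarAlgType R).

Definition is_representation (psi : T -> A) : Prop :=
  [/\ psi (sg_zero S) = 0,
      forall s t, sg_dom S s -> sg_dom S t ->
        psi (sg_mul S s t) = psi s ** psi t &
      forall s, sg_dom S s -> psi (sg_inv S s) = (psi s)^#].

Definition is_tight (psi : T -> A) : Prop :=
  forall X Y Z : seq T, list_sub X idempotents -> list_sub Y idempotents ->
    finite_cover Z (idem_between X Y) ->
    \big[@mjoin R A/m0]_(e <- Z) minj (psi e) =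
    mmeet (\big[@mmeet R A/m1]_(f <- X) minj (psi f))
          (\big[@mmeet R A/m1]_(f <- Y) mcompl (minj (psi f))).

Definition is_tight_representation (psi : T -> A) : Prop :=
  is_representation psi /\ is_tight psi.

End InverseSemigroups.

(** * Ultragraphs

   A choiceType of edges is no restriction in the presence of the axioms of
   boolp; it serves to compare paths and to sum over finite sets of edges. *)

Record ultragraph (V : Type) (E : choiceType) := Ultragraph {
  urange : E -> set V;
  usource : E -> set V;
  urange1 : forall e, exists v, urange e = [set v];
  usource0 : forall e, usource e !=set0 }.

Definition row_finite_without_sources (V : Type) (E : choiceType)
    (U : ultragraph V E) : Prop :=
  forall v, let F := [set e | urange U e = [set v]] in
    F !=set0 /\ finite_set F.

(* The family of generalised vertices. *)
Inductive gvertex (V : Type) (E : choiceType) (U : ultragraph V E)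
    : set V -> Prop :=
| gvertex0 : gvertex U set0
| gvertex1 v : gvertex U [set v]
| gvertexS e : gvertex U (usource U e)
| gvertexI A B : gvertex U A -> gvertex U B -> gvertex U (A `&` B)
| gvertexU A B : gvertex U A -> gvertex U B -> gvertex U (A `|` B)
| gvertexD A B : gvertex U A -> gvertex U B -> gvertex U (A `\` B).

(* Paths, including the universal path of length zero, are lists of edges: the
   empty list is the universal path, and concatenation is [++]. *)
Section Paths.
Variables (V : Type) (E : choiceType) (U : ultragraph V E).

Fixpoint is_path (a : seq E) : Prop :=
  if a is e :: a' then
    (if a' is f :: _ then urange U f `<=` usource U e else True) /\ is_path a'
  else True.

Definition prange (a : seq E) : set V :=
  if a is e :: _ then urange U e else setT.

Definition psource (a : seq E) : set V :=
  if a is e :: a' then usource U (last e a') else setT.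

End Paths.

(** * Self-similar ultragraphs *)

Record selfSimilar (V : Type) (E : choiceType) (G : groupType) := SelfSimilar {
  ugraph :> ultragraph V E;
  ss_row_finite : row_finite_without_sources ugraph;
  ss_countable : countable [set: G];
  actV : G -> V -> V;
  actE : G -> E -> E;
  actV1 : forall v, actV 1%g v = v;
  actVM : forall g h v, actV (g * h)%g v = actV g (actV h v);
  actE1 : forall e, actE 1%g e = e;
  actEM : forall g h e, actE (g * h)%g e = actE g (actE h e);
  act_range : forall g e, urange ugraph (actE g e) = actV g @` urange ugraph e;
  act_source : forall g e,
    usource ugraph (actE g e) = actV g @` usource ugraph e;
  phi : G -> E -> G;
  phiM : forall g h e, phi (g * h)%g e = (phi g (actE h e) * phi h e)%g;
  phi_source : forall g e,
    actV (phi g e) @` usource ugraph e `<=` actV g @` usource ugraph e }.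

Section PathAction.
Variables (V : Type) (E : choiceType) (G : groupType) (S : selfSimilar V E G).

Definition actS (g : G) (A : set V) : set V := actV S g @` A.

Fixpoint actP (g : G) (a : seq E) : seq E :=
  if a is e :: a' then actE S g e :: actP (phi S g e) a' else [::].

Fixpoint phiP (g : G) (a : seq E) : G :=
  if a is e :: a' then phiP (phi S g e) a' else g.

End PathAction.

(** * The inverse semigroup of a self-similar ultragraph *)

Inductive sgu_elt (V : Type) (E : choiceType) (G : groupType) :=
| SGzero
| SGelt of seq E & set V & G & seq E.

Arguments SGzero {V E G}.

Section SGU.
Variables (V : Type) (E : choiceType) (G : groupType) (S : selfSimilar V E G).
Local Notation T := (sgu_elt V E G).

Definition sgu_dom : set T := [set x |
  match x with
  | SGzero => True
  | SGelt a A g b =>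
      [/\ is_path S a, is_path S b, gvertex S A, A <> set0 &
          A `<=` psource S a `&` actS S g (psource S b)]
  end].

Definition sgu_inv (x : T) : T :=
  match x with
  | SGzero => SGzero
  | SGelt a A g b => SGelt b (actS S g^-1%g A) g^-1%g a
  end.

(* When c = b ++ w, the suffix w is [drop (size b) c].  The set g s(w) is the
   pointwise translate of s(w); for a path w of length at least 2 it may differ
   from s(g w), and then [sgu_dom] is not closed under this product: that [sgu]
   is an inverse semigroup is therefore a condition on S. *)
Definition sgu_mul (x y : T) : T :=
  match x, y with
  | SGelt a A g b, SGelt c B h d =>
      let w := drop (size b) c in let w' := drop (size c) b in
      if [&& prefix b c, w != [::] & `[< actS S g (prange S w) `<=` A >]] then
        SGelt (a ++ actP S g w)
              (actS S g (psource S w) `&` actS S (phiP S g w) B)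
              (phiP S g w * h)%g d
      else if [&& prefix c b, w' != [::] & `[< prange S w' `<=` B >]] then
        let k := (g * (phiP S h^-1 w')^-1)%g in
        SGelt a (A `&` actS S (k * h^-1)%g (psource S b)) k
              (d ++ actP S h^-1%g w')
      else if (c == b) && `[< A `&` actS S g B <> set0 >] then
        SGelt a (A `&` actS S g B) (g * h)%g d
      else SGzero
  | _, _ => SGzero
  end.

Definition sgu : invsg_data T := InvSgData sgu_dom sgu_mul sgu_inv SGzero.

End SGU.

(** * The universal C*-algebra *)

(* Only the values p A and u A g at generalised vertices A are relevant. *)
Record gu_data (V E G A : Type) := GUData {
  gu_p : set V -> A;
  gu_s : E -> A;
  gu_u : set V -> G -> A }.

Section Families.
Variables (V : Type) (E : choiceType) (G : groupType) (S : selfSimilar V E G).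
Variable R : realType.

Definition is_CK_family (A : cstarAlgType R) (p : set V -> A) (s : E -> A)
    : Prop :=
  [/\ [/\ forall e, is_partial_isometry (s e),
          forall e f, e != f -> (s e ** (s e)^#) ** (s f ** (s f)^#) = 0 &
          forall X, gvertex S X -> is_proj (p X)],
      [/\ p set0 = 0,
          forall X Y, gvertex S X -> gvertex S Y -> p X ** p Y = p (X `&` Y) &
          forall X Y, gvertex S X -> gvertex S Y ->
            p (X `|` Y) = p X + p Y - p (X `&` Y)],
      forall e, (s e)^# ** s e = p (usource S e),
      forall e, proj_le (s e ** (s e)^#) (p (urange S e)) &
      forall v, p [set v] =
        \sum_(e \in [set e | urange S e = [set v]]) (s e ** (s e)^#)].

Definition is_GU_family (A : cstarAlgType R) (f : gu_data V E G A) : Prop :=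
  let p := gu_p f in let s := gu_s f in let u := gu_u f in
  [/\ is_CK_family p s,
      forall X, gvertex S X -> u X 1%g = p X,
      forall X g, gvertex S X -> (u X g)^# = u (actS S g^-1%g X) g^-1%g,
      forall X Y g h, gvertex S X -> gvertex S Y ->
        u X g ** u Y h = u (X `&` actS S g Y) (g * h)%g &
      forall X g e, gvertex S X ->
        (actS S g (urange S e) `<=` X ->
           u X g ** s e =
           s (actE S g e) ** u (actS S g (usource S e)) (phi S g e)) /\
        (~ actS S g (urange S e) `<=` X -> u X g ** s e = 0)].

Definition gu_generates (A : cstarAlgType R) (f : gu_data V E G A) : Prop :=
  forall D : set A, closed_star_subalg D ->
    (forall X, gvertex S X -> D (gu_p f X)) ->
    (forall e, D (gu_s f e)) ->
    (forall X g, gvertex S X -> D (gu_u f X g)) ->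
    D = setT.

(* The homomorphism into B is unique because f generates O. *)
Definition is_universal_GU_family (O : cstarAlgType R) (f : gu_data V E G O)
    : Prop :=
  [/\ is_GU_family f, gu_generates f &
      forall (B : cstarAlgType R) (f' : gu_data V E G B), is_GU_family f' ->
        exists h : O -> B,
          [/\ star_hom h,
              forall X, gvertex S X -> h (gu_p f X) = gu_p f' X,
              forall e, h (gu_s f e) = gu_s f' e &
              forall X g, gvertex S X -> h (gu_u f X g) = gu_u f' X g]].

Definition spath (O : cstarAlgType R) (s : E -> O) (a : seq E) : multiplier O :=
  \big[@mmul R O/m1]_(e <- a) minj (s e).

(* s_a u_{A,g} s_b^*, computed in M(O); it lies in O because u_{A,g} does. *)
Definition sgu_rep (O : cstarAlgType R) (f : gu_data V E G O)
    (x : sgu_elt V E G) : O :=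
  match x with
  | SGzero => 0
  | SGelt a A g b =>
      rmult (mstar (spath (gu_s f) b)) (lmult (spath (gu_s f) a) (gu_u f A g))
  end.

End Families.

(* Main.v *)
Require Import Defs.
From mathcomp Require Import all_boot all_order all_algebra.
From mathcomp Require Import all_classical all_reals all_analysis.
From mathcomp Require Import complex.

(** Multiplicativity.  The product of s_a u_{A,g} s_b^* and s_c u_{B,h} s_d^* is
   governed by s_b^* s_c, which vanishes unless one of b and c extends the other,
   and otherwise leaves a suffix w (or its adjoint).  The relation
   u_{A,g} s_e = s_{g e} u_{g s(e), phi(g,e)} is iterated to move u across w
   ([u_path]).  The iteration naturally produces the set phi(g,w) s(w), whereas the
   product of the semigroup involves g s(w).  These sets agree because the
   semigroup is closed under its product ([phiP_sourceE]).

   Tightness.  Both sides of the identity are multipliers, and multipliers are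
   determined by their values at the projections p_A, since the family generates O
   ([sgu_rep_nondegenerate]).  Given finitely many idempotents, each idempotent e
   splits: its image is a finite sum of images of idempotents x <= e, each of which
   is below or orthogonal to every idempotent of the given list
   ([sgu_rep_split]).  This uses p_A = p_{A /\ B} + p_{A \ B} and the
   Cuntz-Krieger relation p_v = sum of the s_e s_e^* over the finitely many e with
   range v.  On such an x the projections of X, Y and Z act as truth values, and the
   identity becomes the definition of a cover ([tight_of_split]).  No
   case distinction on X is made: for empty X the unit of M(O) is compared with the
   join on each p_A. *)

Set Implicit Arguments.
Unset Strict Implicit.
Unset Printing Implicit Defensive.

Import Order.TTheory GRing.Theory Num.Theory.
Import numFieldNormedType.Exports.

Local Open Scope classical_set_scope.
Local Open Scope ring_scope.
Local Open Scope cstar_scope.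

(** * Multipliers of a C*-algebra *)

Section CStarAlgebras.
Variables (R : realType) (A : cstarAlgType R).
Implicit Types (x y z : A) (m n : multiplier A).

Lemma cmulNl x y : (- x) ** y = - (x ** y).
Proof. by rewrite -[- x]scaleN1r cmulZl scaleN1r. Qed.

Lemma cmulNr x y : x ** (- y) = - (x ** y).
Proof. by rewrite -[- y]scaleN1r cmulZr scaleN1r. Qed.

Lemma cmulBl x y z : (x - y) ** z = x ** z - y ** z.
Proof. by rewrite cmulDl cmulNl. Qed.

Lemma cmulBr x y z : x ** (y - z) = x ** y - x ** z.
Proof. by rewrite cmulDr cmulNr. Qed.

Lemma cstar0 : (0 : A)^# = 0.
Proof. by have := cstarZ (0 : R[i]) (0 : A); rewrite rmorph0 !scale0r. Qed.

Lemma cstar_eq0 x : x^# = 0 -> x = 0.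
Proof. by move=> x0; rewrite -[x]cstarK x0 cstar0. Qed.

(** The C*-identity makes the algebra faithful on itself; this is why an element,
   and hence a multiplier, is determined by its products. *)
Lemma cstar_mul_eq0 x : x^# ** x = 0 -> x = 0.
Proof.
move=> xx0; apply/eqP; rewrite -normr_eq0 -sqrf_eq0.
by rewrite -cnormC xx0 normr0.
Qed.

Lemma cmul_injl x y : (forall b, x ** b = y ** b) -> x = y.
Proof.
move=> xy; apply/eqP; rewrite -subr_eq0; apply/eqP/cstar_eq0/cstar_mul_eq0.
by rewrite cstarK cmulBl xy subrr.
Qed.

Lemma cmul_injr x y : (forall a, a ** x = a ** y) -> x = y.
Proof.
move=> xy; apply/eqP; rewrite -subr_eq0; apply/eqP/cstar_mul_eq0.
by rewrite cmulBr xy subrr.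
Qed.

Lemma closed_annihilator y : closed [set x | x ** y = 0].
Proof.
move=> x xcl /=; apply/eqP; rewrite -normr_eq0; apply/negP => /negP xy0.
have n0 : 0 < `|x ** y| by rewrite lt_def xy0 normr_ge0.
have c0 : 0 < `|y| + 1 by rewrite ltr_wpDl.
have e0 : 0 < `|x ** y| / (`|y| + 1) by rewrite divr_gt0.
have [z [/= zy0 /=]] := xcl _ (nbhsx_ballx x _ e0).
rewrite -ball_normE /= => xz.
have : `|x ** y| <= `|x - z| * `|y|.
  by rewrite (le_trans _ (cnormM _ _)) // cmulBl zy0 subr0.
move=> le1; have : `|x ** y| <= `|x ** y| / (`|y| + 1) * `|y|.
  by rewrite (le_trans le1) // ler_wpM2r // ltW.
rewrite mulrAC -[leLHS]mulr1 -mulrA ler_pM2l // ler_pdivlMr // mul1r.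
by rewrite gerDl ler10.
Qed.

(** The involution is isometric: |x^#|^2 = |x x^#| <= |x| |x^#|. *)
Lemma closed_preim_cstar (D : set A) :
  closed D -> closed [set x | D x^#].
Proof.
move=> Dcl x xcl /=; apply: Dcl => B /nbhs_ballP[e /= e0 eB].
have [y [/= Dy]] := xcl _ (nbhsx_ballx x _ e0).
rewrite -ball_normE /= => xy; exists y^#; split => //.
apply: eB; rewrite -ball_normE /=; apply: le_lt_trans xy.
have -> : x^# - y^# = (x - y)^#.
  by rewrite cstarD -[- y]scaleN1r cstarZ rmorphN1 scaleN1r.
have [->|xy0] := eqVneq ((x - y)^#) 0; first by rewrite normr0.
rewrite -(ler_pM2r (x := `|(x - y)^#|)) ?normr_gt0 //.
by rewrite -expr2 -cnormC cstarK cnormM.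
Qed.

(** Two multipliers m and n agree on x from the right iff x annihilates all
   differences m b - n b.  The set of such x need not be self-adjoint, so its
   self-adjoint part is taken: that is a closed *-subalgebra, and it can be
   compared with a generating family. *)
Lemma annihilator_subalg (I : Type) (c : I -> A) :
  closed_star_subalg [set x | forall i, x ** c i = 0 /\ x^# ** c i = 0].
Proof.
split => /=.
- have -> : [set x | forall i, x ** c i = 0 /\ x^# ** c i = 0] =
      \bigcap_(i in [set: I]) ([set x | x ** c i = 0] `&` [set x | x^# ** c i = 0]).
    by apply/seteqP; split => x /= h i; [move=> _; exact: h | exact: h].
  apply: closed_bigI => i _; apply: closedI; first exact: closed_annihilator.
  exact: (closed_preim_cstar (@closed_annihilator (c i))).
- by move=> i; rewrite cstar0 !cmul0l.
- move=> x y hx hy i; have [[x1 x2] [y1 y2]] := (hx i, hy i).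
  by rewrite cstarD !cmulDl x1 x2 y1 y2 addr0.
- move=> k x hx i; have [x1 x2] := hx i.
  by rewrite cstarZ !cmulZl x1 x2 !scaler0.
- split=> [x y hx hy i|x hx i]; have [x1 x2] := hx i; last by rewrite cstarK.
  by have [y1 y2] := hy i; rewrite cstarM -!cmulA y1 x2 !cmul0r.
Qed.

Lemma lmultM m x y : lmult m (x ** y) = lmult m x ** y.
Proof. by apply: cmul_injr => a; rewrite cmulA !multP cmulA. Qed.

Lemma rmultM m x y : rmult m (x ** y) = x ** rmult m y.
Proof. by apply: cmul_injl => a; rewrite -cmulA -!multP cmulA. Qed.

Lemma lmultD m x y : lmult m (x + y) = lmult m x + lmult m y.
Proof. by apply: cmul_injr => a; rewrite cmulDr !multP cmulDr. Qed.

Lemma rmultD m x y : rmult m (x + y) = rmult m x + rmult m y.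
Proof. by apply: cmul_injl => a; rewrite cmulDl -!multP cmulDl. Qed.

Lemma lmult0 m : lmult m 0 = 0.
Proof. by apply: cmul_injr => a; rewrite multP !cmul0r. Qed.

Lemma rmult0 m : rmult m 0 = 0.
Proof. by apply: cmul_injl => a; rewrite -multP !cmul0l. Qed.

Lemma lrmultC m n x : lmult m (rmult n x) = rmult n (lmult m x).
Proof. by apply: cmul_injl => a; rewrite -multP -!lmultM multP. Qed.

Lemma multiplier_eq m n : (forall x, rmult m x = rmult n x) -> m = n.
Proof.
move=> mn; have lmn x : lmult m x = lmult n x.
  by apply: cmul_injr => a; rewrite !multP mn.
move: m n mn lmn => [l r P] [l' r' P'] /= /funext rr' /funext ll'.
by move: P P'; rewrite rr' ll' => P P'; rewrite (Prop_irrelevance P P').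
Qed.

(** Finite sums of members of Q, as an inductive closure: sums of sums are then
   again sums without any reindexing. *)
Inductive sum_of (Q : set A) : set A :=
| sum_of0 : sum_of Q 0
| sum_of1 x : Q x -> sum_of Q x
| sum_ofD x y : sum_of Q x -> sum_of Q y -> sum_of Q (x + y).

Lemma sum_of_trans (Q Q' : set A) : Q `<=` sum_of Q' -> sum_of Q `<=` sum_of Q'.
Proof.
move=> QQ' x; elim=> [|y /QQ'//|y z _ Qy _ Qz]; [exact: sum_of0|exact: sum_ofD].
Qed.

Lemma rmult_sum_of (Q : set A) m n :
  (forall x, Q x -> rmult m x = rmult n x) ->
  forall x, sum_of Q x -> rmult m x = rmult n x.
Proof.
move=> mn x; elim=> [|y /mn//|y z _ my _ mz]; first by rewrite !rmult0.
by rewrite !rmultD my mz.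
Qed.

(** The lattice operations multiply in a fixed order, but on an element x that each
   factor either fixes or kills, they behave as the Boolean operations. *)

Section Lattice.
Variables (T : Type) (p : T -> multiplier A).

Lemma rmult_meet_fix (X : seq T) x :
  (forall t, List.In t X -> rmult (p t) x = x) ->
  rmult (\big[@mmeet R A/m1]_(t <- X) p t) x = x.
Proof.
elim: X => [|t X IH] h; first by rewrite big_nil.
by rewrite big_cons /= h ?IH //; [move=> u uX; apply: h; right|left].
Qed.

Lemma rmult_meet_kill (X : seq T) x :
  (forall t, List.In t X -> rmult (p t) x = x \/ rmult (p t) x = 0) ->
  (exists2 t, List.In t X & rmult (p t) x = 0) ->
  rmult (\big[@mmeet R A/m1]_(t <- X) p t) x = 0.
Proof.
elim: X => [|t X IH] h [u] //= uX u0; rewrite big_cons /=.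
have [tx|->] := h t (or_introl erefl); last by rewrite rmult0.
case: uX => [tu|uX]; first by rewrite tu u0 rmult0.
by rewrite tx; apply: IH => [v vX|]; [apply: h; right|exists u].
Qed.

Lemma rmult_join_kill (X : seq T) x :
  (forall t, List.In t X -> rmult (p t) x = 0) ->
  rmult (\big[@mjoin R A/m0]_(t <- X) p t) x = 0.
Proof.
elim: X => [|t X IH] h; first by rewrite big_nil.
rewrite big_cons /= h; last by left.
by rewrite IH ?rmult0 ?addr0 ?subr0 // => u uX; apply: h; right.
Qed.

Lemma rmult_join_fix (X : seq T) x :
  (forall t, List.In t X -> rmult (p t) x = x \/ rmult (p t) x = 0) ->
  (exists2 t, List.In t X & rmult (p t) x = x) ->
  rmult (\big[@mjoin R A/m0]_(t <- X) p t) x = x.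
Proof.
elim: X => [|t X IH] h [u] //= uX ux; rewrite big_cons /=.
have [tx|tx] := h t (or_introl erefl).
  by rewrite tx addrK.
rewrite tx add0r rmult0 subr0.
case: uX => [tu|uX].
  move: tx; rewrite tu ux => ->; exact: rmult0.
by apply: IH => [v vX|]; [apply: h; right|exists u].
Qed.

End Lattice.
End CStarAlgebras.

(** * A criterion for tightness *)

Section Tightness.
Variables (T : Type) (S : invsg_data T) (R : realType) (A : cstarAlgType R).
Variable psi : T -> A.
Hypothesis hS : is_inverse_semigroup0 S.
Hypothesis psi_rep : is_representation S psi.

Local Notation idem := (idempotents S).
Local Notation mul := (sg_mul S).
Local Notation zero := (sg_zero S).

(** An idempotent x decides l if it lies below l or is orthogonal to l; on such an
   x the projection of l acts as a truth value. *)
Definition decides (x l : T) : Prop := mul x l = x \/ mul x l = zero.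

Hypothesis psi_split : forall e l, idem e -> idem l ->
  sum_of [set psi x | x in [set x | [/\ idem x, mul x e = x & decides x l]]]
    (psi e).
Hypothesis psi_nondegenerate : forall m n : multiplier A,
  (forall e, idem e -> rmult m (psi e) = rmult n (psi e)) -> m = n.

Lemma decides_le e x l : idem e -> idem x -> idem l ->
  mul x e = x -> decides e l -> decides x l.
Proof.
case: hS => _ assoc z0 _ _ [De _] [Dx _] [Dl _] xe.
rewrite /decides -xe -assoc // => -[] ->; first by left.
by right; have [] := z0 _ Dx.
Qed.

(** Deciding l survives passing to a smaller idempotent, so the members of a list
   can be decided one after the other. *)
Lemma psi_split_list e (L : seq T) : idem e -> list_sub L idem ->
  sum_of [set psi x | x in [set x | idem x /\
    forall l, List.In l L -> decides x l]] (psi e).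
Proof.
move=> ie; elim: L => [|l L IH] hL.
  by apply: sum_of1; exists e => //; split.
have il : idem l by apply: hL; left.
apply: sum_of_trans (IH _) => [_ [x [ix xL] <-]|k kL]; last first.
  by apply: hL; right.
apply: sum_of_trans (psi_split ix il) => _ [y [iy yx yl] <-].
apply: sum_of1; exists y => //; split=> // k [<- //|kL].
by apply: (decides_le ix) => //; [apply: hL; right|exact: xL].
Qed.

(** It suffices to compare both sides of the tightness identity on an idempotent e
   that decides all of X, Y and Z.  If e lies in the set covered by Z, some z in Z
   meets e, so e <= z and both sides fix psi e.  If not, e is orthogonal to some
   x in X or lies below some y in Y; as every z is below x and orthogonal to y,
   e is orthogonal to all of Z, and both sides kill psi e. *)
Lemma tight_of_split : is_tight S psi.
Proof.
case: hS => [[D0 Dm _] assoc z0 _ _]; case: psi_rep => psi0 psiM _.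
have InE (s t : seq T) x : List.In x (s ++ t) <-> List.In x s \/ List.In x t.
  exact: List.in_app_iff.
move=> X Y Z hX hY [hZ cov]; apply: psi_nondegenerate => e ie.
pose F := [set x | idem x /\
  forall l, List.In l (X ++ Y ++ Z) -> decides x l].
have := @psi_split_list e (X ++ Y ++ Z) ie; rewrite -/F => hF.
have {}hF : sum_of (psi @` F) (psi e).
  apply: hF => l /InE[|/InE[]]; [exact: hX|exact: hY|by move=> /hZ[]].
apply: rmult_sum_of hF => {e ie} _ [e [[De ee] eL] <-].
have [->|e0] := pselect (e = zero); first by rewrite psi0 !rmult0.
have eX f : List.In f X -> decides e f.
  by move=> fX; apply: eL; apply/InE; left.
have eY f : List.In f Y -> decides e f.
  by move=> fY; apply: eL; apply/InE; right; apply/InE; left.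
have eZ f : List.In f Z -> decides e f.
  by move=> fZ; apply: eL; apply/InE; right; apply/InE; right.
have rE f : sg_dom S f -> rmult (minj (psi f)) (psi e) = psi (mul e f).
  by move=> Df; rewrite psiM.
have dec (L : seq T) : list_sub L (sg_dom S) ->
    (forall f, List.In f L -> decides e f) ->
    forall f, List.In f L -> rmult (minj (psi f)) (psi e) = psi e \/
      rmult (minj (psi f)) (psi e) = 0.
  move=> DL eLL f fL; rewrite rE; last exact: DL.
  by have [->|->] := eLL f fL; [left|right].
have DX : list_sub X (sg_dom S) by move=> f /hX[].
have DY : list_sub Y (sg_dom S) by move=> f /hY[].
have DZ : list_sub Z (sg_dom S) by move=> f /hZ[[]].
have decC f : List.In f Y ->
    rmult (mcompl (minj (psi f))) (psi e) = psi e \/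
    rmult (mcompl (minj (psi f))) (psi e) = 0.
  move=> fY; have := dec _ DY eY f fY; rewrite /=.
  by move=> [] ->; [right; rewrite subrr|left; rewrite subr0].
have Zkill : (forall f, List.In f Z -> mul e f = zero) ->
    rmult (\big[@mjoin R A/m0]_(f <- Z) minj (psi f)) (psi e) = 0.
  move=> h; apply: rmult_join_kill => f fZ.
  by rewrite rE ?h //; exact: DZ.
have [allX|/existsNP[x /not_implyP[xX exn]]] :=
    pselect (forall x, List.In x X -> mul e x = e); last first.
  have ex0 : mul e x = zero by case: (eX x xX).
  rewrite Zkill; last first.
    move=> z zZ; have [ez|//] := eZ z zZ; exfalso; apply: e0.
    have [_ zX _] := hZ z zZ.
    by rewrite -ez -(zX x xX) assoc ?ez; [| |exact: DZ|exact: DX].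
  rewrite /mmeet /= (rmult_meet_kill (x := psi e)) ?rmult0 //.
    exact: dec.
  by exists x => //; rewrite rE ?ex0 //; exact: DX.
have [allY|/existsNP[y /not_implyP[yY eyn]]] :=
    pselect (forall y, List.In y Y -> mul e y = zero); last first.
  have ey : mul e y = e by case: (eY y yY).
  rewrite Zkill; last first.
    move=> z zZ; have [ez|//] := eZ z zZ; exfalso; apply: eyn.
    have [_ _ zY] := hZ z zZ.
    rewrite -ez -assoc //; [|exact: DZ|exact: DY].
    by rewrite (zY y yY) (z0 e De).2.
  rewrite /mmeet /= [rmult _ (psi e)]rmult_meet_fix; last first.
    by move=> f fX; rewrite rE ?allX //; exact: DX.
  rewrite rmult_meet_kill //; exists y => //.
  by rewrite /= -psiM ?ey ?subrr //; exact: DY.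
have [z zZ ezn] : exists2 z, List.In z Z & mul e z <> zero.
  by apply: cov => //; split.
have ez : mul e z = e by case: (eZ z zZ).
rewrite rmult_join_fix; last 2 first.
- exact: dec.
- by exists z => //; rewrite rE ?ez //; exact: DZ.
rewrite /mmeet /= [rmult (\big[_/_]_(f <- X) _) _]rmult_meet_fix; last first.
  by move=> f fX; rewrite rE ?allX //; exact: DX.
rewrite rmult_meet_fix // => f fY /=.
by rewrite -psiM ?allY ?psi0 ?subr0 //; exact: DY.
Qed.

End Tightness.

(** * Paths and the action of the group *)

Section PathTheory.
Variables (V : Type) (E : choiceType) (U : ultragraph V E).

Lemma urange_sub e A : urange U e `<=` A -> exists2 v, urange U e = [set v] & A v.
Proof. by case: (urange1 U e) => v -> h; exists v => //; exact: h. Qed.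

Lemma psource_cat a e w : psource U (a ++ e :: w) = psource U (e :: w).
Proof. by case: a => [|f a] //=; rewrite last_cat. Qed.

Lemma is_path_cat a e w : is_path U (a ++ e :: w) <->
  [/\ is_path U a, is_path U (e :: w) & urange U e `<=` psource U a].
Proof.
elim: a => [|f a IH]; first by split=> [p|[]//]; split=> //.
case: a IH => [|g a] IH; first by split=> [[? ?]//|[_ ? ?]]; split.
have -> : is_path U ((f :: g :: a) ++ e :: w) =
  (urange U g `<=` usource U f /\ is_path U ((g :: a) ++ e :: w)) by [].
by rewrite IH; split=> [[? []]//|[[? ?] ? ?]]; split.
Qed.

End PathTheory.

Section GroupActions.
Variables (V : Type) (E : choiceType) (G : groupType) (S : selfSimilar V E G).
Implicit Types (g h : G) (e : E) (w : seq E) (A B : set V).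

Lemma actVK g v : actV S g^-1%g (actV S g v) = v.
Proof. by rewrite -actVM mulVg actV1. Qed.

Lemma actS1 A : actS S 1%g A = A.
Proof.
apply/seteqP; split=> [_ [v Av <-]|v Av]; first by rewrite actV1.
by exists v => //; rewrite actV1.
Qed.

Lemma actSM g h A : actS S (g * h)%g A = actS S g (actS S h A).
Proof.
apply/seteqP; split=> [_ [v Av <-]|_ [_ [v Av <-] <-]].
  by rewrite actVM; exists (actV S h v) => //; exists v.
by exists v => //; rewrite actVM.
Qed.

Lemma actSK g A : actS S g^-1%g (actS S g A) = A.
Proof. by rewrite -actSM mulVg actS1. Qed.

Lemma actSVK g A : actS S g (actS S g^-1%g A) = A.
Proof. by rewrite -actSM mulgV actS1. Qed.

Lemma actS_sub g A B : A `<=` B -> actS S g A `<=` actS S g B.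
Proof. exact: image_subset. Qed.

Lemma actS_subE g A B : (actS S g A `<=` actS S g B) <-> (A `<=` B).
Proof.
split=> [|AB]; last exact: actS_sub.
by move=> /(@actS_sub g^-1%g); rewrite !actSK.
Qed.

Lemma actS0 g : actS S g set0 = set0.
Proof. exact: image_set0. Qed.

Lemma actSset1 g v : actS S g [set v] = [set actV S g v].
Proof. exact: image_set1. Qed.

Lemma actSI g A B : actS S g (A `&` B) = actS S g A `&` actS S g B.
Proof.
apply/seteqP; split=> [_ [v [Av Bv] <-]|_ [[v Av <-] [w Bw wv]]].
  by split; exists v.
exists v => //; split=> //; rewrite -(actVK g v) -wv actVK //.
Qed.

Lemma actSD g A B : actS S g (A `\` B) = actS S g A `\` actS S g B.
Proof.
apply/seteqP; split=> [_ [v [Av Bv] <-]|_ [[v Av <-] Bv]].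
  split; first by exists v.
  by move=> [w Bw wv]; apply: Bv; rewrite -(actVK g v) -wv actVK.
by exists v => //; split=> // Bv'; apply: Bv; exists v.
Qed.

Lemma gvertex_actS g A : gvertex S A -> gvertex S (actS S g A).
Proof.
elim=> {A} [|v|e|A B _ hA _ hB|A B _ hA _ hB|A B _ hA _ hB].
- by rewrite actS0; exact: gvertex0.
- by rewrite actSset1; exact: gvertex1.
- by rewrite /actS -act_source; exact: gvertexS.
- by rewrite actSI; exact: gvertexI.
- by rewrite /actS image_setU; exact: gvertexU.
- by rewrite actSD; exact: gvertexD.
Qed.

Lemma gvertex_urange e : gvertex S (urange S e).
Proof. by have [v ->] := urange1 S e; exact: gvertex1. Qed.

Lemma phi1 e : phi S 1%g e = 1%g.
Proof.
apply: (mulgI (phi S 1%g e)).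
by have := phiM S 1%g 1%g e; rewrite actE1 !mulg1.
Qed.

(** Applying the inclusion phi(g,e) s(e) <= g s(e) to g^-1 and g e gives the reverse
   one, because phi(g^-1, g e) is the inverse of phi(g,e). *)
Lemma phi_sourceE g e : actS S (phi S g e) (usource S e) = actS S g (usource S e).
Proof.
apply/seteqP; split; first exact: phi_source.
have : phi S g^-1%g (actE S g e) = (phi S g e)^-1%g.
  apply: (mulIg (phi S g e)); rewrite -phiM mulVg phi1 mulVg //.
move=> phiV; have := @phi_source _ _ _ S g^-1%g (actE S g e).
rewrite phiV act_source -!/(actS S _ _) actSK => /(@actS_sub (phi S g e)).
by rewrite actSVK.
Qed.

Lemma actP1 w : actP S 1%g w = w.
Proof. by elim: w => //= e w IH; rewrite actE1 phi1 IH. Qed.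

Lemma phiP1 w : phiP S 1%g w = 1%g.
Proof. by elim: w => //= e w IH; rewrite phi1. Qed.

Lemma actP_path g w : is_path S w -> is_path S (actP S g w).
Proof.
elim: w g => //= e [|f w] IH g [ef pw]; first by split.
split; last exact: IH.
rewrite /= act_range act_source -!/(actS S _ _) -phi_sourceE.
exact: actS_sub.
Qed.

Section Closed.
Hypothesis hS : is_inverse_semigroup0 (sgu S).

(** For a path of length at least 2 the source of g w is phi(g,w) s(w), which the
   axioms of a self-similar ultragraph do not relate to g s(w).  The inverse
   semigroup does: multiplying the element at g r(w) by the element at {v}, v in
   s(w), gives the set of those points of g s(w) that equal phi(g,w) v.  By
   the rule for the product it is not replaced by zero even if that set is empty;
   but it belongs to the semigroup, whose nonzero elements carry nonempty sets. *)
Lemma phiP_source_sub g e w : is_path S (e :: w) ->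
  actS S (phiP S g (e :: w)) (psource S (e :: w)) `<=`
  actS S g (psource S (e :: w)).
Proof.
move=> pw _ [v sv <-]; have [[_ Dm _] _ _ _ _] := hS.
have [r rE] := urange1 S e.
have D1 : sgu_dom S (SGelt [::] (actS S g (urange S e)) g [::]).
  rewrite rE actSset1; split=> //; first exact: gvertex1.
    by move=> /seteqP[/(_ _ erefl)].
  by move=> x _; split=> //; exists (actV S g^-1%g x) => //; rewrite -actVM mulgV actV1.
have D2 : sgu_dom S (SGelt (e :: w) [set v] 1%g (e :: w)).
  split=> //; first exact: gvertex1.
    by move=> /seteqP[/(_ _ erefl)].
  by move=> _ ->; rewrite actS1.
have := Dm _ _ D1 D2; rewrite /= asboolT //=.
case=> _ _ _ /eqP/set0P[x []] /=; rewrite actSset1 => gs xE _.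
by rewrite -[X in _ X]xE.
Qed.

(** As for edges, the reverse inclusion is the same one for g^-1 and the path g w. *)
Lemma phiP_sourceE g e w : is_path S (e :: w) ->
  actS S (phiP S g (e :: w)) (psource S (e :: w)) =
  actS S g (psource S (e :: w)).
Proof.
move=> pw; apply/seteqP; split; first exact: phiP_source_sub.
have phiV : forall w g, phiP S g^-1%g (actP S g w) = (phiP S g w)^-1%g.
  elim=> //= f u IH h.
  rewrite -IH; congr phiP; apply: (mulIg (phi S h f)).
  by rewrite -phiM !mulVg phi1.
have := @phiP_source_sub g^-1%g (actE S g e) (actP S (phi S g e) w).
have -> : psource S (actE S g e :: actP S (phi S g e) w) =
    actS S (phiP S g (e :: w)) (psource S (e :: w)).
  rewrite /=; elim: w e g {pw} => [|f w IH] e g /=.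
    by rewrite phi_sourceE act_source.
  by rewrite IH.
move=> /(_ (@actP_path g _ pw)); rewrite (phiV (e :: w) g) actSK.
by move=> /(@actS_sub g); rewrite actSVK.
Qed.

End Closed.
End GroupActions.

(** * The map into the C*-algebra is multiplicative *)

Section Families.
Variables (V : Type) (E : choiceType) (G : groupType) (S : selfSimilar V E G).
Variables (R : realType) (O : cstarAlgType R) (f : gu_data V E G O).
Hypothesis hf : is_GU_family S f.

Local Notation p := (gu_p f).
Local Notation s := (gu_s f).
Local Notation u := (gu_u f).
Local Notation gv := (gvertex S).
Implicit Types (x y : O) (a b c w : seq E) (A B X : set V) (g h : G) (e : E).

Lemma p_proj X : gv X -> p X ** p X = p X /\ (p X)^# = p X.
Proof. by case: hf => -[[_ _ +] _ _ _ _] _ _ _ _; apply. Qed.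

Lemma p_set0 : p set0 = 0.
Proof. by case: hf => -[_ [+ _ _] _ _ _] _ _ _ _. Qed.

Lemma p_setI X Y : gv X -> gv Y -> p X ** p Y = p (X `&` Y).
Proof. by case: hf => -[_ [_ + _] _ _ _] _ _ _ _; apply. Qed.

Lemma p_setU X Y : gv X -> gv Y -> p (X `|` Y) = p X + p Y - p (X `&` Y).
Proof. by case: hf => -[_ [_ _ +] _ _ _] _ _ _ _; apply. Qed.

Lemma s_pi e : s e ** (s e)^# ** s e = s e.
Proof. by case: hf => -[[+ _ _] _ _ _ _] _ _ _ _; apply. Qed.

Lemma ss_source e : (s e)^# ** s e = p (usource S e).
Proof. by case: hf => -[_ _ + _ _] _ _ _ _; apply. Qed.

Lemma u_one X : gv X -> u X 1%g = p X.
Proof. by case: hf => _ + _ _ _; apply. Qed.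

Lemma u_star X g : gv X -> (u X g)^# = u (actS S g^-1%g X) g^-1%g.
Proof. by case: hf => _ _ + _ _; apply. Qed.

Lemma u_mul X Y g h : gv X -> gv Y ->
  u X g ** u Y h = u (X `&` actS S g Y) (g * h)%g.
Proof. by case: hf => _ _ _ + _; apply. Qed.

Lemma u_s X g e : gv X -> actS S g (urange S e) `<=` X ->
  u X g ** s e = s (actE S g e) ** u (actS S g (usource S e)) (phi S g e).
Proof. by case: hf => _ _ _ _ + gX; move=> /(_ X g e gX)[+ _]; apply. Qed.

Lemma u_s0 X g e : gv X -> ~ actS S g (urange S e) `<=` X -> u X g ** s e = 0.
Proof. by case: hf => _ _ _ _ + gX; move=> /(_ X g e gX)[_]; apply. Qed.

Lemma s_source e : s e ** p (usource S e) = s e.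
Proof. by rewrite -ss_source cmulA s_pi. Qed.

Lemma p_sub X Y : gv X -> gv Y -> Y `<=` X -> p X ** p Y = p Y.
Proof. by move=> gX gY YX; rewrite p_setI // setIidr. Qed.

Lemma p_s X e : gv X -> urange S e `<=` X -> p X ** s e = s e.
Proof.
case: hf => -[_ _ _ + _] _ _ _ _ => /(_ e) le gX eX.
have gr : gv (urange S e) by exact: gvertex_urange.
have rs : p (urange S e) ** s e = s e.
  have [_ pr] := p_proj gr.
  have [] : s e ** (s e)^# ** p (urange S e) = s e ** (s e)^# by exact: le.
  move=> /(congr1 (@cstar R O)); rewrite !cstarM cstarK pr => h.
  by rewrite -[in LHS]s_pi cmulA h s_pi.
by rewrite -rs cmulA p_sub.
Qed.

Lemma s_orth e e' : e != e' -> (s e)^# ** s e' = 0.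
Proof.
case: hf => -[[_ + _] _ _ _ _] _ _ _ _ => /(_ e e') /[apply] h.
have -> : (s e)^# ** s e' =
    (s e)^# ** ((s e ** (s e)^#) ** (s e' ** (s e')^#)) ** s e'.
  rewrite -!cmulA [s e' ** (_ ** _)]cmulA s_pi !cmulA.
  by rewrite -[in LHS](s_pi e) !cstarM cstarK !cmulA.
by rewrite h cmul0r cmul0l.
Qed.

Lemma u_empty g : u set0 g = 0.
Proof.
have := u_mul 1%g g (gvertex0 S) (gvertex0 S).
by rewrite set0I mul1g u_one ?p_set0 ?cmul0l //; exact: gvertex0.
Qed.

Lemma p_u X B g : gv X -> gv B -> B `<=` X -> p X ** u B g = u B g.
Proof.
move=> gX gB BX; rewrite -u_one // u_mul // mul1g actS1.
by congr (u _ _); exact: setIidr.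
Qed.

Lemma u_p X g : gv X -> u X g ** p (actS S g^-1%g X) = u X g.
Proof.
move=> gX; have gX' := gvertex_actS g^-1%g gX.
by rewrite -u_one // u_mul // mulg1 actSVK setIid.
Qed.

(** In M(O): sl a x = s_a x, sr a x = x s_a^*, slV a x = s_a^* x. *)
Definition sl a x := lmult (spath s a) x.
Definition sr a x := rmult (mstar (spath s a)) x.
Definition slV a x := lmult (mstar (spath s a)) x.

Lemma sl_cons e a x : sl (e :: a) x = s e ** sl a x.
Proof. by rewrite /sl /spath big_cons. Qed.

Lemma sl_cat a b x : sl (a ++ b) x = sl a (sl b x).
Proof.
by elim: a => [|e a IH]; [rewrite /sl /spath big_nil|rewrite !sl_cons IH].
Qed.

Lemma slV_cons e a x : slV (e :: a) x = slV a ((s e)^# ** x).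
Proof. by rewrite /slV /spath big_cons /= cstarM cstarK. Qed.

Lemma slV_cat a b x : slV (a ++ b) x = slV b (slV a x).
Proof.
elim: a x => [|e a IH] x; last by rewrite /= !slV_cons IH.
by rewrite /= [slV [::] x]/slV /spath big_nil /= cstarK.
Qed.

Lemma srE a x : sr a x = (sl a x^#)^#. Proof. by []. Qed.

Lemma sr_cat a b x : sr (a ++ b) x = sr a (sr b x).
Proof. by rewrite !srE sl_cat cstarK. Qed.

Lemma cmul_sl_star a x y : y ** (sl a x)^# = sr a (y ** x^#).
Proof. by rewrite /sr rmultM /= cstarK. Qed.

Lemma slV0 a : slV a 0 = 0. Proof. exact: lmult0. Qed.

(** For nonempty b, s_b^* s_b is the projection of s(b): inner factors
   s_e^* s_e = p_{s(e)} are absorbed by the next edge, whose range lies in s(e). *)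
Lemma slV_sl b x : (b <> [::] -> p (psource S b) ** x = x) ->
  is_path S b -> slV b (sl b x) = x.
Proof.
elim: b x => [|e [|e' b] IH] x h pb.
- by rewrite /slV /sl /spath big_nil /= cstarK.
- rewrite slV_cons !sl_cons cmulA ss_source /slV /sl /spath !big_nil /= cstarK.
  exact: h.
rewrite slV_cons sl_cons cmulA ss_source.
have -> : p (usource S e) ** sl (e' :: b) x = sl (e' :: b) x.
  rewrite sl_cons cmulA p_s //; first exact: gvertexS.
  by case: pb.
by apply: IH; [move=> _; exact: h | case: pb].
Qed.

Lemma slV_orth b c x : is_path S c -> ~~ prefix b c -> ~~ prefix c b ->
  slV b (sl c x) = 0.
Proof.
elim: b c => [|e b IH] [|e' c] //= pc; rewrite slV_cons sl_cons cmulA.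
have [ee|ne] := eqVneq e e'; last by rewrite s_orth // cmul0l slV0.
rewrite -{e'}ee in pc *; rewrite /= ss_source => bc cb.
case: c pc bc cb => [|e'' c] [ec pc] bc cb; first by rewrite prefix0s in cb.
rewrite sl_cons cmulA p_s //; last exact: gvertexS.
by rewrite -sl_cons; apply: IH.
Qed.

Section Closed.
Hypothesis hS : is_inverse_semigroup0 (sgu S).

(** The commutation relation for edges, iterated along a path.  The set produced by
   the iteration is phi(g,e) s(w) rather than g s(w); the two agree by
   [phiP_sourceE], which is where closedness of the semigroup enters. *)
Lemma u_path X g e w : gv X -> is_path S (e :: w) ->
  actS S g (urange S e) `<=` X ->
  rmult (spath s (e :: w)) (u X g) =
  sl (actP S g (e :: w))
    (u (actS S g (psource S (e :: w))) (phiP S g (e :: w))).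
Proof.
elim: w e g X => [|e' w IH] e g X gX pw eX.
  by rewrite /sl /spath !big_cons !big_nil /= u_s.
rewrite /spath big_cons /= -/(spath s (e' :: w)) u_s // rmultM.
case: (pw) => ee' pw'; rewrite IH //; last 2 first.
- exact/gvertex_actS/gvertexS.
- by rewrite -phi_sourceE; exact: actS_sub.
rewrite [RHS]sl_cons; congr (_ ** sl _ (u _ _)).
have := phiP_sourceE hS g pw; rewrite /= => <-.
by rewrite -(phiP_sourceE hS (phi S g e) pw').
Qed.

Lemma u_path0 X g e w : gv X -> ~ actS S g (urange S e) `<=` X ->
  rmult (spath s (e :: w)) (u X g) = 0.
Proof. by move=> gX neX; rewrite /spath big_cons /= u_s0 // rmult0. Qed.

Lemma u_slV B h w : gv B ->
  slV w (u B h) = (rmult (spath s w) (u (actS S h^-1%g B) h^-1%g))^#.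
Proof. by move=> gB; rewrite -u_star. Qed.

Lemma sgu_repE a A g b : sgu_rep f (SGelt a A g b) = sr b (sl a (u A g)).
Proof. by []. Qed.

(** Everything reduces to computing s_b^* s_c, according to which of b and c is a
   prefix of the other; the group part then moves across the remaining suffix by
   [u_path], or by its adjoint when b is the longer path. *)
Lemma sgu_rep_mul (x y : sgu_elt V E G) : sgu_dom S x -> sgu_dom S y ->
  sgu_rep f (sgu_mul S x y) = sgu_rep f x ** sgu_rep f y.
Proof.
case: x y => [|a A g b] [|c B h d] Dx Dy; rewrite ?cmul0l ?cmul0r //.
case: Dx Dy => pa pb gA _ sA [pc pd gB _ sB].
have gS w : w <> [::] -> gv (psource S w).
  by case: w => // e w _; exact: gvertexS.
(* Written as s_a (u (s_b^* s_c v)) s_d^*, only the inner product depends on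
   how b and c compare. *)
have -> : sgu_rep f (SGelt a A g b) ** sgu_rep f (SGelt c B h d) =
    sr d (sl a (u A g ** slV b (sl c (u B h)))).
  by rewrite !sgu_repE /sr -rmultM -multP -lmultM.
have vs w : w <> [::] -> B `<=` psource S w -> p (psource S w) ** u B h = u B h.
  by move=> w0 Bw; apply: p_u => //; exact: gS.
have sBc : B `<=` psource S c by move=> v /sB[].
rewrite /sgu_mul.
have [/prefixP[w cE]|nbc] := boolP (prefix b c).
  rewrite cE drop_size_cat //; subst c.
  case: w => [|e w] in pc sB sBc *.
    rewrite cats0 drop_size prefix_refl /= eqxx /=.
    rewrite cats0 in pc sB sBc.
    rewrite slV_sl //; last by move=> b0; exact: vs.
    rewrite u_mul //; case: asboolP => // /contrapT ->.
    by rewrite u_empty /sl /sr lmult0 rmult0.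
  have [pb' pw ebs] := (is_path_cat _ _ _ _).1 pc.
  rewrite /= sl_cat slV_sl //; last first.
    move=> b0; rewrite sl_cons cmulA p_s //; exact: gS.
  have -> : u A g ** sl (e :: w) (u B h) =
      rmult (spath s (e :: w)) (u A g) ** u B h by rewrite -multP.
  case: asboolP => eA; last first.
    have -> : prefix (b ++ e :: w) b = false.
      apply/negP => /size_prefix; rewrite size_cat /= addnS ltnNge leq_addr //.
    rewrite /=; have -> : (b ++ e :: w == b) = false.
      apply/negP => /eqP/(congr1 size); rewrite size_cat /= => /eqP.
      by rewrite -[X in _ == X]addn0 eqn_add2l.
    by rewrite /= u_path0 // cmul0l /sl /sr lmult0 rmult0.
  rewrite u_path // -[sl _ _ ** _]lmultM sgu_repE u_mul //; last first.
    by apply: gvertex_actS; exact: gvertexS.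
  by rewrite -sl_cat.
have [/prefixP[w bE]|ncb] := boolP (prefix c b); last first.
  rewrite slV_orth // cmul0r /sl /sr lmult0 rmult0 /=.
  by case: eqP => // cb; move: nbc; rewrite cb prefix_refl.
subst b; rewrite drop_size_cat //.
have := nbc; case: w => [|e w] in pb sA nbc *; first by rewrite cats0 prefix_refl.
move=> _; have [_ pw ebs] := (is_path_cat _ _ _ _).1 pb.
rewrite slV_cat slV_sl //; last by move=> c0; exact: vs.
rewrite u_slV // /=; case: asboolP => eB.
  rewrite u_path //; [|exact: gvertex_actS|exact: actS_sub].
  have gs : gv (actS S h^-1%g (psource S (e :: w))).
    by apply: gvertex_actS; exact: gvertexS.
  rewrite sgu_repE cmul_sl_star u_star // u_mul //; last exact: gvertex_actS.
  rewrite sr_cat /sl /sr lrmultC psource_cat; congr (rmult _ (rmult _ (lmult _ (u _ _)))).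
  by rewrite !actSM.
rewrite u_path0 ?cstar0 ?cmul0r; last 2 first.
- exact: gvertex_actS.
- by move=> /actS_subE.
have -> : (c == c ++ e :: w) = false.
  apply/negP => /eqP/(congr1 size); rewrite size_cat /= => /eqP.
  by rewrite -[X in X == _]addn0 eqn_add2l.
by rewrite /= /sl /sr lmult0 rmult0.
Qed.

Lemma sgu_rep_star (x : sgu_elt V E G) : sgu_dom S x ->
  sgu_rep f (sgu_inv S x) = (sgu_rep f x)^#.
Proof.
case: x => [|a A g b]; first by rewrite cstar0.
case=> pa pb gA _ _; rewrite sgu_repE [sgu_inv _ _]/= sgu_repE -u_star //.
rewrite [in RHS]srE cstarK -[in RHS](cstarK (u A g)).
by rewrite -srE /sl /sr lrmultC.
Qed.

Lemma sgu_rep_representation : is_representation (sgu S) (sgu_rep f).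
Proof. by split=> //; [exact: sgu_rep_mul|exact: sgu_rep_star]. Qed.
End Closed.

End Families.

(** * Idempotents of the semigroup *)

Section Idempotents.
Variables (V : Type) (E : choiceType) (G : groupType) (S : selfSimilar V E G).
Local Notation gv := (gvertex S).
Local Notation mul := (sgu_mul S).
Implicit Types (a b c w : seq E) (A B X : set V) (g h : G) (e : E).

(** The idempotent (a, A, 1, a), extended by zero to A empty so that splitting A
   never has to distinguish cases. *)
Definition idem_at a A : sgu_elt V E G :=
  if `[< A = set0 >] then SGzero else SGelt a A 1%g a.

Definition supports a A : Prop := [/\ is_path S a, gv A & A `<=` psource S a].

Lemma sgu_mulx0 x : mul x SGzero = SGzero.
Proof. by case: x. Qed.

Lemma not_prefix_cat a e w : prefix (a ++ e :: w) a = false.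
Proof.
by apply/negP => /size_prefix; rewrite size_cat /= addnS ltnNge leq_addr.
Qed.

Lemma cat_cons_neq a e w : (a ++ e :: w == a) = false.
Proof.
apply/negP => /eqP ae; have := not_prefix_cat a e w.
by rewrite ae prefix_refl.
Qed.

Lemma idem_at0 a : idem_at a set0 = SGzero.
Proof. by rewrite /idem_at asboolT. Qed.

Lemma idem_atE a A : A <> set0 -> idem_at a A = SGelt a A 1%g a.
Proof. by move=> A0; rewrite /idem_at asboolF. Qed.

Lemma mul_idem_at_same a A B :
  mul (idem_at a A) (idem_at a B) = idem_at a (A `&` B).
Proof.
have [->|A0] := pselect (A = set0); first by rewrite set0I !idem_at0.
have [->|B0] := pselect (B = set0).
  by rewrite setI0 !idem_at0 sgu_mulx0.
rewrite (idem_atE _ A0) (idem_atE _ B0) /= drop_size prefix_refl eqxx /= actS1 mulg1.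
have [AB|AB] := pselect (A `&` B = set0).
  by rewrite AB idem_at0 asboolF // andbF.
by rewrite idem_atE // eqxx asboolT.
Qed.

Lemma mul_idem_at_long c e w A B : supports (c ++ e :: w) B ->
  mul (idem_at (c ++ e :: w) B) (idem_at c A) =
  if `[< urange S e `<=` A >] then idem_at (c ++ e :: w) B else SGzero.
Proof.
case=> _ _ sB; have [->|B0] := pselect (B = set0).
  by rewrite idem_at0 if_same.
have [->|A0] := pselect (A = set0).
  rewrite asboolF ?idem_at0 ?sgu_mulx0 // => h; have [v ve] := urange1 S e.
  by have := h v; rewrite ve; exact.
rewrite (idem_atE _ A0) (idem_atE _ B0).
rewrite /= not_prefix_cat /= drop_size_cat // prefix_prefix /=.
case: asboolP => // eA; last by rewrite eq_sym cat_cons_neq.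
rewrite !invg1 !mul1g !mulg1 actE1 phi1 actP1 phiP1 invg1 actS1.
by congr (SGelt _ _ _ _); apply: setIidl.
Qed.

Lemma mul_idem_at_short c e w A B : ~ urange S e `<=` B ->
  mul (idem_at c B) (idem_at (c ++ e :: w) A) = SGzero.
Proof.
move=> eB; have [->|B0] := pselect (B = set0); first by rewrite idem_at0.
have [->|A0] := pselect (A = set0); first by rewrite idem_at0 sgu_mulx0.
rewrite (idem_atE _ A0) (idem_atE _ B0) /= drop_size_cat // prefix_prefix /= actS1.
by rewrite asboolF //= not_prefix_cat /= cat_cons_neq.
Qed.

Lemma mul_idem_at_orth a c A B : ~~ prefix a c -> ~~ prefix c a ->
  mul (idem_at a A) (idem_at c B) = SGzero.
Proof.
move=> ac ca; have [->|A0] := pselect (A = set0); first by rewrite idem_at0.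
have [->|B0] := pselect (B = set0); first by rewrite idem_at0 sgu_mulx0.
rewrite (idem_atE _ A0) (idem_atE _ B0).
rewrite /= (negbTE ac) (negbTE ca) /=; case: eqP => //= ec.
by rewrite ec prefix_refl in ac.
Qed.

Lemma idem_at_idem a A : supports a A -> idempotents (sgu S) (idem_at a A).
Proof.
move=> [pa gA sA]; split; last by rewrite /= mul_idem_at_same setIid.
rewrite /idem_at; case: asboolP => // A0; split=> //.
by rewrite actS1 => v Av; split; exact: sA.
Qed.

(** If a <> b, the square of (a, A, g, b) is zero or has a strictly longer path; so a
   nonzero idempotent has a = b, and then g g = g. *)
Lemma idem_atP x : idempotents (sgu S) x ->
  exists a A, supports a A /\ x = idem_at a A.
Proof.
case: x => [_|a A g b].
  exists [::], set0; split; last by rewrite /idem_at asboolT.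
  by split=> //; exact: gvertex0.
case=> -[pa pb gA A0 sA]; rewrite /=; case: ifP.
  case/and3P => _ w0 _ [aE _ _]; exfalso.
  have := congr1 size aE; rewrite size_cat => /eqP.
  rewrite -[X in _ == X]addn0 eqn_add2l size_eq0.
  by case: (drop _ _) w0.
move=> _; case: ifP.
  case/and3P => _ w0 _ [_ _ bE]; exfalso.
  have := congr1 size bE; rewrite size_cat => /eqP.
  rewrite -[X in _ == X]addn0 eqn_add2l size_eq0.
  by case: (drop _ _) w0.
move=> _; case: ifP => // /andP[/eqP ab _] [_ gg].
have g1 : g = 1%g by apply: (mulgI g); rewrite gg mulg1.
exists a, A; rewrite /idem_at asboolF //; split; last by rewrite g1 ab.
by split=> // v /sA[].
Qed.

End Idempotents.

(** * Splitting idempotents, and tightness *)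

Section Splitting.
Variables (V : Type) (E : choiceType) (G : groupType) (S : selfSimilar V E G).
Variables (R : realType) (O : cstarAlgType R) (f : gu_data V E G O).
Hypothesis hS : is_inverse_semigroup0 (sgu S).
Hypothesis hf : is_GU_family S f.

Local Notation p := (gu_p f).
Local Notation s := (gu_s f).
Local Notation gv := (gvertex S).
Local Notation mul := (sgu_mul S).
Local Notation psi := (sgu_rep f).
Local Notation sl := (sl f).
Local Notation sr := (sr f).

Lemma sgu_rep_idem a A : gv A -> psi (idem_at G a A) = sr a (sl a (p A)).
Proof.
move=> gA; rewrite /idem_at; case: asboolP => [->|A0].
  by rewrite (p_set0 hf) /sl /sr lmult0 rmult0.
by rewrite sgu_repE (u_one hf).
Qed.

(** Each generator is fixed on the right by some p_X, and so is its adjoint; hence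
   multipliers that agree on the p_X agree on all of O. *)
Lemma sgu_rep_nondegenerate : gu_generates S f -> forall m n : multiplier O,
  (forall e, idempotents (sgu S) e -> rmult m (psi e) = rmult n (psi e)) ->
  m = n.
Proof.
move=> gen m n mn.
have mnp X : gv X -> rmult m (p X) = rmult n (p X).
  move=> gX; have sX : supports S [::] X by split.
  have := mn _ (idem_at_idem sX); rewrite sgu_rep_idem // /sl /sr /spath.
  by rewrite big_nil /= cstarK.
pose D := [set x : O | forall b,
  x ** (lmult m b - lmult n b) = 0 /\ x^# ** (lmult m b - lmult n b) = 0].
have Dp x y X Y : gv X -> gv Y -> x ** p X = x -> y ** p Y = y -> x^# = y ->
    D x.
  move=> gX gY xX yY xy b.
  by rewrite xy -xX -yY -!cmulA !cmulBr !multP !mnp // !subrr.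
have DT : D = setT.
  apply: gen; first exact: annihilator_subalg.
  - by move=> X gX; have [pp ps] := p_proj hf gX; exact: (Dp _ (p X) X X).
  - move=> e; apply: (Dp _ (s e)^# (usource S e) (urange S e)) => //.
    + exact: gvertexS.
    + exact: gvertex_urange.
    + exact: s_source.
    + have gr := gvertex_urange S e.
      by rewrite -(p_proj hf gr).2 -cstarM (p_s hf).
  - move=> X g gX.
    apply: (Dp _ (gu_u f (actS S g^-1%g X) g^-1%g) (actS S g^-1%g X)
               (actS S g^-1%g^-1%g (actS S g^-1%g X))).
    + exact: gvertex_actS.
    + by do 2 apply: gvertex_actS.
    + exact: u_p.
    + by apply: u_p => //; exact: gvertex_actS.
    + exact: u_star.
apply: multiplier_eq => x; apply: cmul_injl => b.
have : D x by rewrite DT.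
by move=> /(_ b)[+ _]; rewrite cmulBr !multP => /eqP; rewrite subr_eq0 => /eqP.
Qed.

Local Notation idem := (idempotents (sgu S)).
Local Notation below e l := [set x | [/\ idem x, mul x e = x &
  decides (sgu S) x l]].

Lemma below_le e e' l : idem e -> idem e' -> mul e' e = e' ->
  below e' l `<=` below e l.
Proof.
case: hS => _ assoc _ _ _ [De _] [De' _] le x [[Dx xx] xe xl]; split=> //.
by rewrite -[in LHS]xe -[LHS]assoc // [sg_mul _ e' e]le.
Qed.

Lemma sum_of_below_le e e' l : idem e -> idem e' -> mul e' e = e' ->
  sum_of (psi @` below e' l) `<=` sum_of (psi @` below e l).
Proof.
move=> ie ie' le; apply: sum_of_trans => _ [x /(below_le ie ie' le) bx <-].
by apply: sum_of1; exists x.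
Qed.

Lemma below_self e l : idem e -> decides (sgu S) e l ->
  sum_of (psi @` below e l) (psi e).
Proof. by move=> ie el; apply: sum_of1; exists e => //; split=> //; case: ie. Qed.

Lemma p_setID A B : gv A -> gv B -> p A = p (A `&` B) + p (A `\` B).
Proof.
move=> gA gB; rewrite -[in LHS](setUIDK A B) (p_setU hf); last 2 first.
- exact: gvertexI.
- exact: gvertexD.
have -> : (A `&` B) `&` (A `\` B) = set0.
  by apply/seteqP; split=> // v [[_ Bv] [_ nBv]].
by rewrite (p_set0 hf) subr0.
Qed.

Lemma sgu_rep_setID a A B : gv A -> gv B ->
  psi (idem_at G a A) = psi (idem_at G a (A `&` B)) + psi (idem_at G a (A `\` B)).
Proof.
move=> gA gB; rewrite !sgu_rep_idem //; [|exact: gvertexD|exact: gvertexI].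
by rewrite -rmultD -lmultD -p_setID.
Qed.

(** The Cuntz-Krieger relation at v, transported along a; row-finiteness makes the
   sum finite. *)
Lemma sgu_rep_vertex a v :
  psi (idem_at G a [set v]) =
  \sum_(e \in [set e | urange S e = [set v]])
     psi (idem_at G (rcons a e) (usource S e)).
Proof.
have [_ fin] := ss_row_finite S v.
rewrite sgu_rep_idem; last exact: gvertex1.
have [[_ _ _ _ +] _ _ _ _] := hf => /(_ v) ->.
rewrite !fsbig_finite //.
have sumE (h : O -> O) : h 0 = 0 -> {morph h : x y / x + y} ->
    forall (r : seq E) F, h (\sum_(e <- r) F e) = \sum_(e <- r) h (F e).
  by move=> h0 hD r F; exact: (big_morph h hD h0).
rewrite (sumE (sl a)) ?(sumE (sr a)) //; last 4 first.
- exact: rmult0.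
- exact: rmultD.
- exact: lmult0.
- exact: lmultD.
apply: eq_bigr => e _; rewrite sgu_rep_idem; last exact: gvertexS.
rewrite -cats1 sl_cat sr_cat; congr (sr a _).
rewrite /sl /sr -lrmultC; congr (lmult _ _).
by rewrite /spath !big_cons !big_nil /= (s_source hf) cstarM cstarK.
Qed.

(** If r(w) = {v} is not contained in B, the two idempotents are orthogonal.
   Otherwise, to decide (c w, A), the point v is split off from B, its part is
   expanded over the edges into v, and only the branch along the first edge of w
   still has to be split: this is the recursion on w.  When w is exhausted, B is
   cut by A. *)
Lemma sgu_rep_split_extension w c A B : supports S c B -> supports S (c ++ w) A ->
  let e := idem_at G c B in
  sum_of (psi @` below e (idem_at G (c ++ w) A)) (psi e).
Proof.
elim: w c B => [|e w IH] c B sB sA /=; have ie := idem_at_idem sB.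
  rewrite cats0 in sA *; have [[pc gB cB] [_ gA cA]] := (sB, sA).
  have sI : supports S c (B `&` A) by split=> //; [exact: gvertexI|move=> v [/cB]].
  have sD : supports S c (B `\` A) by split=> //; [exact: gvertexD|move=> v [/cB]].
  rewrite (sgu_rep_setID _ gB gA); apply: sum_ofD; apply: sum_of1.
    eexists; last reflexivity; split; first exact: idem_at_idem.
      by rewrite mul_idem_at_same setIAC setIid.
    by left; rewrite /= mul_idem_at_same -setIA setIid.
  eexists; last reflexivity; split; first exact: idem_at_idem.
    by rewrite mul_idem_at_same; congr (idem_at _ _ _); apply: setIidl => v [].
  right; rewrite /= mul_idem_at_same.
  have -> : (B `\` A) `&` A = set0 by apply/seteqP; split=> // v [[]].
  by rewrite /idem_at asboolT.
have [eB|neB] := pselect (urange S e `<=` B); last first.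
  by apply: below_self => //; right; exact: mul_idem_at_short.
have [v ev Bv] := urange_sub eB; have [pc gB cB] := sB.
have g1 := gvertex1 S v; have vB : [set v] `<=` B by move=> _ ->.
have sD : supports S c (B `\` [set v]).
  by split=> //; [exact: gvertexD|move=> x [/cB]].
rewrite (sgu_rep_setID _ gB g1); apply: sum_ofD; last first.
  apply: sum_of1; eexists; last reflexivity; split; first exact: idem_at_idem.
    by rewrite mul_idem_at_same; congr (idem_at _ _ _); apply: setIidl => x [].
  by right; apply: mul_idem_at_short; rewrite ev => /(_ v erefl)[_ []].
have [_ fin] := ss_row_finite S v.
rewrite setIidr // sgu_rep_vertex fsbig_finite //= big_seq_cond; apply: big_ind.
- exact: sum_of0.
- by move=> x y; exact: sum_ofD.
move=> e'.
rewrite andbT in_fset_set // inE /= => e'v.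
have pce' : is_path S (rcons c e').
  rewrite -cats1; apply/is_path_cat; split=> //.
  by rewrite e'v => _ ->; exact: cB.
have sce' : supports S (rcons c e') (usource S e').
  by split=> //; [exact: gvertexS|rewrite -cats1 psource_cat].
have le : mul (idem_at G (rcons c e') (usource S e')) (idem_at G c B) =
    idem_at G (rcons c e') (usource S e').
  rewrite -cats1 in sce' *.
  by rewrite mul_idem_at_long // asboolT // e'v.
have ie' := idem_at_idem sce'.
apply: (sum_of_below_le ie ie' le).
have [ee'|ne] := eqVneq e' e.
  by rewrite ee' -cat_rcons in sA sce' *; exact: IH.
apply: below_self => //; right; apply: mul_idem_at_orth.
  by elim: (c) => [|x d IHd] /=; rewrite ?(negbTE ne) ?eqxx.
by elim: (c) => [|x d IHd] /=; rewrite ?[e == e']eq_sym ?(negbTE ne) ?eqxx.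
Qed.

(** If the path of l does not extend that of e, then e already decides l. *)
Lemma sgu_rep_split e l : idem e -> idem l -> sum_of (psi @` below e l) (psi e).
Proof.
move=> ie il; have [c [B [sB eE]]] := idem_atP ie.
have [a [A [sA lE]]] := idem_atP il; rewrite eE lE in ie il *.
have [/prefixP[w aE]|nca] := boolP (prefix c a).
  by rewrite aE in sA *; exact: sgu_rep_split_extension.
apply: below_self => //; have [/prefixP[[|x w] cE]|nac] := boolP (prefix a c).
- by rewrite cE cats0 prefix_refl in nca.
- rewrite cE in sB *; rewrite /decides /= mul_idem_at_long //.
  by case: asboolP => _; [left|right].
- by right; exact: mul_idem_at_orth.
Qed.

End Splitting.

Theorem theorem8p2 (R : realType) (V : Type) (E : choiceType) (G : groupType)
    (S : selfSimilar V E G) (O : cstarAlgType R) (f : gu_data V E G O)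
    (hS : is_inverse_semigroup0 (sgu S))
    (hO : is_universal_GU_family S f) :
  is_tight_representation (sgu S) (sgu_rep f).
Proof.
have [hf gen _] := hO; have rep := sgu_rep_representation hf hS.
split=> //; apply: tight_of_split => //.
- by move=> e l ie il; exact: sgu_rep_split.
- exact: sgu_rep_nondegenerate.
Qed.
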